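(* Let $\mathcal{H}$ be an infinite-dimensional separable real Hilbert space with unit sphere $\mathcal{S} = \{x \in \mathcal{H} : \|x\| = 1\}$, let $n \geq 1$, let $x_1,\ldots,x_n \in \mathcal{S}$, let $u \in \mathcal{S} \cap \mathrm{span}(x_1,\ldots,x_n)^\perp$ be arbitrary, and let $\phi : [0,\infty) \to \mathbb{R}$. Let $G \in \mathbb{R}^{n\times n}$ be the Gram matrix with entries $G_{ij} = \langle x_i, x_j\rangle$, let $r$ be the number of non-zero eigenvalues of $G$ (counted with multiplicity), and write $G = V\Lambda V^{T}$ for the truncated eigendecomposition, where $\Lambda \in \mathbb{R}^{r\times r}$ is the diagonal matrix of non-zero eigenvalues and $V \in \mathbb{R}^{n\times r}$ has as columns corresponding orthonormal eigenvectors. For $i = 1,\ldots,n$ let $y_i \in \mathbb{R}^{r+1}$ be the $i$-th row of $V\Lambda^{1/2}$ with a $0$ appended as last coordinate, so that $y_i$ lies in the unit sphere $\mathbb{S}^r$ of $\mathbb{R}^{r+1}$, and let $v = (0,\ldots,0,1)^{T} \in \mathbb{R}^{r+1}$. Let $\tilde{m} \in \mathbb{S}^r$ be a sample $\phi$-centre of mass of $y_1,\ldots,y_n$, i.e. a global minimiser over $m \in \mathbb{S}^r$ of $$n^{-1}\sum_{i=1}^n \phi\{\arccos(m^{T} y_i)\},$$ and let $\tilde\alpha_1,\ldots,\tilde\alpha_n,\tilde\beta \in \mathbb{R}$ be any coefficients such that $\tilde{m} = \sum_{j=1}^n \tilde\alpha_j y_j + \tilde\beta v$. Then $$\hat{m}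 = \sum_{j=1}^n \tilde\alpha_j x_j + \tilde\beta u$$ is a sample $\phi$-centre of mass of $x_1,\ldots,x_n$; that is, $\hat{m} \in \mathcal{S}$ and $\hat{m}$ minimises $$F_\phi^{(n)}(m) = n^{-1}\sum_{i=1}^n \phi\{d_{\mathcal{S}}(m,x_i)\}$$ over $m \in \mathcal{S}$.
   Context: The inner product and norm of $\mathcal{H}$ are $\langle \cdot,\cdot\rangle$ and $\|\cdot\| = \langle\cdot,\cdot\rangle^{1/2}$. The sphere $\mathcal{S}$ carries the great-arc distance $d_{\mathcal{S}}(x,x') = \arccos(\langle x,x'\rangle) \in [0,\pi]$, and $\mathbb{S}^r = \{y \in \mathbb{R}^{r+1} : y^{T}y = 1\}$ carries the distance $\arccos(y^{T}y')$. A sample $\phi$-centre of mass of finitely many points on a sphere is a global minimiser, over that sphere, of the average of $\phi$ applied to the distances to the points. *)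

(* Defs.v *)
From mathcomp Require Export all_boot all_order all_algebra.
From mathcomp Require Export all_classical all_reals all_analysis.
Export numFieldNormedType.Exports.
Export Order.TTheory GRing.Theory Num.Theory.

Set Implicit Arguments.
Unset Strict Implicit.
Unset Printing Implicit Defensive.

Local Open Scope classical_set_scope.
Local Open Scope ring_scope.

(* A real Hilbert space is rendered as a [completeNormedModType R] with a
   symmetric positive definite bilinear form [ip : {dot H for idfun}] that
   induces its norm, in the sense of [norm_of_inner ip]. *)
Definition norm_of_inner (R : realType) (H : completeNormedModType R)
    (ip : {dot H for idfun}) : Prop :=
  forall x : H, `|x| = Num.sqrt (ip x x).

Definition lin_span (R : realType) (V : lmodType R) (k : nat)
    (e : 'I_k -> V) : set V :=
  [set z | exists a : 'I_k -> R, z = \sum_(i < k) a i *: e i].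

Definition finite_dimensional (R : realType) (V : lmodType R) : Prop :=
  exists (k : nat) (e : 'I_k -> V), lin_span e = setT.

Definition infinite_dimensional (R : realType) (V : lmodType R) : Prop :=
  ~ finite_dimensional V.

Definition separable_space (T : topologicalType) : Prop :=
  exists2 D : set T, countable D & dense D.

Definition orth_compl (R : realType) (V : lmodType R)
    (ip : {dot V for idfun}) (A : set V) : set V :=
  [set z | forall w, A w -> ip z w = 0].

Definition unit_sphere (R : realType) (H : completeNormedModType R) : set H :=
  [set x | `|x| = 1].
Arguments unit_sphere {R} H.

Definition dist_sphere (R : realType) (V : lmodType R)
    (ip : {dot V for idfun}) (x x' : V) : R :=
  acos (ip x x').

(* The library's norm on matrices is the sup norm, so the Euclidean sphere of
   R^k is described by the dot product instead. *)
Definition euclid_dot (R : realType) (k : nat) (y y' : 'cV[R]_k) : R :=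
  (y^T *m y') 0 0.

Definition euclid_sphere (R : realType) (k : nat) : set 'cV[R]_k :=
  [set y | euclid_dot y y = 1].
Arguments euclid_sphere : clear implicits.

Definition dist_euclid_sphere (R : realType) (k : nat) (y y' : 'cV[R]_k) : R :=
  acos (euclid_dot y y').

(* A function phi : [0, oo) -> R is represented by a total function; on the
   spheres it is only ever applied to values of [acos] on [-1, 1], which lie
   in [0, pi]. *)
Definition mean_loss (R : realType) (T : Type) (d : T -> T -> R)
    (phi : R -> R) (n : nat) (x : 'I_n -> T) (m : T) : R :=
  n%:R^-1 * \sum_(i < n) phi (d m (x i)).

Definition center_of_mass (R : realType) (T : Type) (S : set T)
    (d : T -> T -> R) (phi : R -> R) (n : nat) (x : 'I_n -> T) (m : T) : Prop :=
  S m /\ forall m', S m' -> mean_loss d phi x m <= mean_loss d phi x m'.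

Definition gram (R : realType) (V : lmodType R) (ip : {dot V for idfun})
    (n : nat) (x : 'I_n -> V) : 'M[R]_n :=
  \matrix_(i, j) ip (x i) (x j).

(* [s] lists the eigenvalues of [A] with their multiplicities. *)
Definition spectrum_of (R : realType) (n : nat) (A : 'M[R]_n) (s : seq R) :
    Prop :=
  char_poly A = \prod_(a <- s) ('X - a%:P).

(* [A = V Lambda V^T] with [Lambda = diag_mx lam]: the entries of [lam] are the
   nonzero eigenvalues of [A] with multiplicity (in any order), so that [r] is
   their number, and the columns of [V] are corresponding orthonormal
   eigenvectors. *)
Record truncated_eigendecomposition (R : realType) (n r : nat) (A : 'M[R]_n)
    (V : 'M[R]_(n, r)) (lam : 'rV[R]_r) : Prop := TruncatedEigendecomposition {
  ted_spectrum : exists2 s, spectrum_of A s &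
    perm_eq [seq lam 0 j | j : 'I_r] [seq a <- s | a != 0] ;
  ted_eigenvectors : forall j, A *m col j V = lam 0 j *: col j V ;
  ted_orthonormal : V^T *m V = 1%:M ;
  ted_decomposition : A = V *m diag_mx lam *m V^T
}.

Definition nonzero_eigenvalue_count (R : realType) (n : nat) (A : 'M[R]_n)
    (r : nat) : Prop :=
  exists2 s, spectrum_of A s & r = count (fun a => a != 0) s.

Definition embedded_point (R : realType) (n r : nat) (V : 'M[R]_(n, r))
    (lam : 'rV[R]_r) (i : 'I_n) : 'cV[R]_(r + 1) :=
  col_mx (row i (V *m diag_mx (map_mx Num.sqrt lam)))^T 0.

Definition last_axis (R : realType) (r : nat) : 'cV[R]_(r + 1) :=
  col_mx 0 1%:M.

(* Main.v *)
(* For W = V Lambda^(1/2) one has W W^T = G, so the rows of W reproduce the inner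
   products of the x_i, and m-tilde has the same norm and the same inner products
   with the y_i as m-hat has with the x_i: the two losses agree.  Conversely,
   for any m' on the sphere of H, the coordinates t of its projection onto
   span(x) satisfy W t = (<m', x_i>)_i and |t| <= 1; completing t by the last
   coordinate sqrt(1 - |t|^2) gives a point of S^r with the same loss as m'.  So
   every loss attained on the sphere of H is attained on S^r, and the minimality
   of m-tilde transfers to m-hat. *)
Require Import Defs.
From mathcomp Require Import lra.

Set Implicit Arguments.
Unset Strict Implicit.
Unset Printing Implicit Defensive.

Local Open Scope classical_set_scope.
Local Open Scope ring_scope.

Lemma euclid_dot_col_mx (R : realType) p q (a a' : 'cV[R]_p) (c c' : 'cV[R]_q) :
  euclid_dot (col_mx a c) (col_mx a' c') = euclid_dot a a' + euclid_dot c c'.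
Proof. by rewrite /euclid_dot tr_col_mx mul_row_col mxE. Qed.

Section DotProduct.
Variables (R : realType) (H : lmodType R) (ip : {dot H for idfun}).

Lemma ip_sym (z w : H) : ip z w = ip w z.
Proof. by rewrite hermC /= expr0 mul1r. Qed.

Lemma ip_ge0 (z : H) : 0 <= ip z z.
Proof.
have [->|z0] := eqVneq z 0; first by rewrite linear0l.
exact/ltW/neq0_dnorm_gt0.
Qed.

Lemma ip_eq0 (z : H) : ip z z = 0 -> z = 0.
Proof.
move=> zz0; apply/eqP; apply: contraPT (zz0) => /(@neq0_dnorm_gt0 _ _ _ ip).
by rewrite zz0 ltxx.
Qed.

Variables (n : nat) (x : 'I_n -> H).

Definition lincomb (c : 'cV[R]_n) : H := \sum_(i < n) c i 0 *: x i.

Definition ip_col (z : H) : 'cV[R]_n := \col_i ip z (x i).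

Lemma ip_lincombr (z : H) (c : 'cV[R]_n) :
  ip z (lincomb c) = ((ip_col z)^T *m c) 0 0.
Proof.
rewrite linear_sumr mxE; apply: eq_bigr => i _.
by rewrite linearZr_LR !mxE mulrC.
Qed.

Lemma ip_col_lincomb (c : 'cV[R]_n) : ip_col (lincomb c) = gram ip x *m c.
Proof.
apply/colP => i; rewrite !mxE linear_sumlz; apply: eq_bigr => j _.
by rewrite linearZl_LR mxE /= mulrC ip_sym.
Qed.

Lemma gram_sym : (gram ip x)^T = gram ip x.
Proof. by apply/matrixP => i j; rewrite !mxE ip_sym. Qed.

Lemma ip_lincomb (c d : 'cV[R]_n) :
  ip (lincomb c) (lincomb d) = (c^T *m gram ip x *m d) 0 0.
Proof. by rewrite ip_lincombr ip_col_lincomb trmx_mul gram_sym. Qed.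

Lemma gram_psd (c : 'cV[R]_n) : 0 <= (c^T *m gram ip x *m c) 0 0.
Proof. by rewrite -ip_lincomb ip_ge0. Qed.

(** The kernel of the Gram matrix consists of the linear relations among the [x i]: if [G c = 0],
    then [lincomb c] has squared norm [c^T G c = 0], hence vanishes and pairs to 0 with every
    [z]. *)
Lemma ip_col_orth_ker_gram (z : H) m (C : 'M[R]_(n, m)) :
  gram ip x *m C = 0 -> (ip_col z)^T *m C = 0.
Proof.
move=> GC0; apply/rowP => j; rewrite [RHS]mxE.
have Gc0 : gram ip x *m col j C = 0 by rewrite colE mulmxA GC0 mul0mx.
have xc0 : lincomb (col j C) = 0.
  by apply: ip_eq0; rewrite ip_lincomb -mulmxA Gc0 mulmx0 mxE.
have := ip_lincombr z (col j C); rewrite xc0 linear0r colE mulmxA -colE.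
by rewrite [in RHS]mxE => <-.
Qed.

Lemma ip_lincomb_orth (u : H) (c : 'cV[R]_n) :
  orth_compl ip (lin_span x) u -> ip u (lincomb c) = 0.
Proof. by apply; exists (c^~ 0). Qed.

Section Eigendecomposition.
Variables (r : nat) (V : 'M[R]_(n, r)) (lam : 'rV[R]_r).
Hypothesis VlamE : truncated_eigendecomposition (gram ip x) V lam.

(** Only nonzero eigenvalues are listed in [lam], and each equals [v^T G v >= 0] for its unit
    eigenvector [v]. *)
Lemma gram_eigenvalue_gt0 j : 0 < lam 0 j.
Proof.
have [[s _ lams] eigV VV _] := VlamE.
rewrite lt0r; apply/andP; split.
  have : lam 0 j \in [seq a <- s | a != 0].
    by rewrite -(perm_mem lams); apply: map_f; rewrite mem_enum.
  by rewrite mem_filter => /andP[].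
have := gram_psd (col j V).
rewrite -mulmxA eigV -scalemxAr mxE.
suff -> : ((col j V)^T *m col j V) 0 0 = 1 by rewrite mulr1.
by rewrite tr_col -row_mul colE mulmxA VV mul1mx !mxE !eqxx.
Qed.

Let W := V *m diag_mx (map_mx Num.sqrt lam).

Lemma sqrt_factor_gram : W *m W^T = gram ip x.
Proof.
have [_ _ _ ->] := VlamE.
rewrite trmx_mul tr_diag_mx mulmxA -[W *m _]mulmxA mulmx_diag.
congr (_ *m diag_mx _ *m _); apply/rowP => j.
by rewrite !mxE -expr2 sqr_sqrtr // ltW // gram_eigenvalue_gt0.
Qed.

(** [V *m V^T] projects orthogonally onto the range of the Gram matrix. Since [1 - V V^T] maps into
    its kernel, to which [ip_col z] is orthogonal, [ip_col z] is fixed. *)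
Lemma ip_col_proj (z : H) : V *m V^T *m ip_col z = ip_col z.
Proof.
have [_ _ VV GE] := VlamE.
have : gram ip x *m (1%:M - V *m V^T) = 0.
  rewrite mulmxBr mulmx1 mulmxA GE -[_ *m V^T *m V]mulmxA VV mulmx1.
  exact: subrr.
move/(ip_col_orth_ker_gram z)/(congr1 trmx)/eqP.
rewrite mulmxBr mulmx1 linearB /= !trmx_mul !trmxK trmx0 subr_eq0.
by move/eqP <-.
Qed.

(* [t] lists the coordinates of the orthogonal projection of [z] onto the span
   of [x] in the orthonormal basis [lam_k^(-1/2) \sum_i V_ik x_i], so that the
   inequality is Bessel's. *)
Lemma bessel_coordinates (z : H) :
  exists2 t : 'cV[R]_r, W *m t = ip_col z & (t^T *m t) 0 0 <= ip z z.
Proof.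
have [_ _ VV GE] := VlamE.
set b := ip_col z.
pose s := \row_j (Num.sqrt (lam 0 j))^-1.
pose d := \row_j (lam 0 j)^-1.
have sqrt_neq0 j : Num.sqrt (lam 0 j) != 0.
  by rewrite gt_eqF // sqrtr_gt0 gram_eigenvalue_gt0.
have ssE : diag_mx s *m diag_mx s = diag_mx d.
  rewrite mulmx_diag; congr diag_mx; apply/rowP => j.
  rewrite !mxE -invfM -expr2 sqr_sqrtr // ltW //.
  exact: gram_eigenvalue_gt0.
(* With this witness [W t] collapses to [V V^T b], which is [b]. *)
exists (diag_mx s *m V^T *m b).
  rewrite -[RHS]ip_col_proj !mulmxA -[W *m _]mulmxA mulmx_diag.
  suff -> : (\row_j (map_mx Num.sqrt lam 0 j * s 0 j)) = const_mx 1.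
    by rewrite diag_const_mx mulmx1.
  by apply/rowP => j; rewrite !mxE divff.
(* The pseudo-inverse of the Gram matrix applied to [b]: [lincomb c] is the orthogonal projection of
   [z] onto the span of [x]. *)
pose c := V *m diag_mx d *m V^T *m b.
have bcE : (diag_mx s *m V^T *m b)^T *m (diag_mx s *m V^T *m b) = b^T *m c.
  by rewrite !trmx_mul trmxK tr_diag_mx /c -ssE !mulmxA.
have ccE : c^T *m gram ip x *m c = b^T *m c.
  rewrite GE /c !trmx_mul trmxK tr_diag_mx !mulmxA.
  rewrite -[_ *m V^T *m V]mulmxA VV mulmx1.
  rewrite -[_ *m V^T *m V]mulmxA VV mulmx1.
  rewrite -[_ *m diag_mx lam *m _]mulmxA mulmx_diag.
  rewrite -[_ *m diag_mx d *m diag_mx _]mulmxA mulmx_diag.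
  congr (_ *m diag_mx _ *m _ *m _); apply/rowP => j.
  by rewrite !mxE mulfV ?mulr1 // gt_eqF // gram_eigenvalue_gt0.
(* The squared distance expands to [ip z z - 2 b^T c + c^T G c], that is [ip z z - b^T c], and
   [b^T c] is the squared length of the witness. *)
have := ip_ge0 (z - lincomb c).
rewrite linearBl /= !linearBr /= (ip_sym (lincomb c) z).
rewrite ip_lincomb ip_lincombr ccE bcE -/b.
lra.
Qed.

Lemma embedded_pointE i : embedded_point V lam i = col_mx (row i W)^T 0.
Proof. by []. Qed.

(** The last coordinate of an embedded point is 0, so [c] drops out; it remains free to adjust the
    norm. *)
Lemma euclid_dot_embedded_point (t : 'cV[R]_r) (c : 'cV[R]_1) i :
  euclid_dot (col_mx t c) (embedded_point V lam i) = (W *m t) i 0.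
Proof.
rewrite embedded_pointE euclid_dot_col_mx /euclid_dot mulmx0.
rewrite [X in _ + X]mxE addr0.
by rewrite -trmx_mul mxE -row_mul mxE.
Qed.

Lemma embedded_combE (alpha : 'I_n -> R) (beta : R) :
  \sum_(j < n) alpha j *: embedded_point V lam j + beta *: last_axis R r =
  col_mx (W^T *m \col_j alpha j) beta%:M.
Proof.
apply/colP => k; rewrite mxE summxE [in X in _ + X]mxE.
case: (split_ordP k) => l ->.
  rewrite !col_mxEu mxE mulr0 addr0 [RHS]mxE.
  apply: eq_bigr => j _.
  by rewrite mxE embedded_pointE col_mxEu !mxE mulrC.
rewrite !col_mxEd !ord1 big1 => [|j _]; last first.
  by rewrite mxE embedded_pointE col_mxEd mxE mulr0.
by rewrite !mxE mulr1 mulr1n add0r.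
Qed.
End Eigendecomposition.
End DotProduct.

Theorem proposition2
  (R : realType) (H : completeNormedModType R) (ip : {dot H for idfun})
  (Hnorm : norm_of_inner ip)
  (Hinf : infinite_dimensional H)
  (Hsep : separable_space H)
  (n : nat) (n_ge1 : (1 <= n)%N)
  (x : 'I_n -> H) (xS : forall i, unit_sphere H (x i))
  (u : H) (uS : (unit_sphere H `&` orth_compl ip (lin_span x)) u)
  (phi : R -> R)
  (r : nat) (rE : nonzero_eigenvalue_count (gram ip x) r)
  (V : 'M[R]_(n, r)) (lam : 'rV[R]_r)
  (VlamE : truncated_eigendecomposition (gram ip x) V lam)
  (mt : 'cV[R]_(r + 1))
  (mtP : center_of_mass (euclid_sphere R (r + 1))
           (@dist_euclid_sphere R (r + 1)) phi (embedded_point V lam) mt)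
  (alpha : 'I_n -> R) (beta : R)
  (mtE : mt = \sum_(j < n) alpha j *: embedded_point V lam j
              + beta *: last_axis R r) :
  center_of_mass (unit_sphere H) (dist_sphere ip) phi x
    (\sum_(j < n) alpha j *: x j + beta *: u).
Proof.
case: uS => u1 uorth.
have [mtS mt_min] := mtP.
have sqr_norm (z : H) : ip z z = `|z| ^+ 2 by rewrite Hnorm sqr_sqrtr ?ip_ge0.
set a := \col_j alpha j.
have hatE : \sum_(j < n) alpha j *: x j + beta *: u = lincomb x a + beta *: u.
  by congr (_ + _); apply: eq_bigr => j _; rewrite mxE.
have xu : ip (lincomb x a) u = 0 by rewrite ip_sym ip_lincomb_orth.
pose W := V *m diag_mx (map_mx Num.sqrt lam).
have {}mtE : mt = col_mx (W^T *m a) beta%:M by rewrite mtE embedded_combE.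
have loss_eq (z : H) (y : 'cV[R]_(r + 1)) :
    (forall i, euclid_dot y (embedded_point V lam i) = ip z (x i)) ->
    mean_loss (dist_sphere ip) phi x z =
    mean_loss (@dist_euclid_sphere R (r + 1)) phi (embedded_point V lam) y.
  move=> yz; congr (_ * _); apply: eq_bigr => i _.
  by rewrite /dist_sphere /dist_euclid_sphere yz.
rewrite hatE; split.
  (* The cross terms vanish because [u] is orthogonal to the span; what is left is
     [a^T W W^T a + beta^2], the squared length of [mt]. *)
  rewrite /unit_sphere /= Hnorm -[RHS]sqrtr1; congr Num.sqrt.
  rewrite linearDl /= !linearDr /= !linearZl_LR !linearZr_LR /=.
  rewrite (ip_sym ip u) xu (sqr_norm u) u1 expr1n !mulr0 addr0 add0r mulr1.
  rewrite ip_lincomb -(sqrt_factor_gram VlamE) -/W.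
  move: mtS; rewrite /euclid_sphere /= mtE euclid_dot_col_mx /euclid_dot.
  rewrite trmx_mul trmxK !mulmxA tr_scalar_mx -scalar_mxM => <-.
  by congr (_ + _); rewrite mxE mulr1n.
have -> : mean_loss (dist_sphere ip) phi x (lincomb x a + beta *: u) =
    mean_loss (@dist_euclid_sphere R (r + 1)) phi (embedded_point V lam) mt.
  apply: loss_eq => i.
  rewrite mtE euclid_dot_embedded_point -/W mulmxA (sqrt_factor_gram VlamE).
  rewrite -ip_col_lincomb mxE linearDl linearZl_LR /=.
  have -> : ip u (x i) = 0.
    apply: uorth; exists (fun j => (j == i)%:R).
    rewrite (bigD1 i) //= eqxx scale1r big1 ?addr0 // => j /negPf ->.
    by rewrite scale0r.
  by rewrite mulr0 addr0.
move=> m' m'1; have [t Wt tle] := bessel_coordinates VlamE m'.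
rewrite (sqr_norm m') m'1 expr1n in tle.
(* By [tle] the radicand is nonnegative, so [Num.sqrt] does not fall back on its default value 0 and
   [q] squares to it. *)
pose q := Num.sqrt (1 - euclid_dot t t).
rewrite (loss_eq m' (col_mx t q%:M)).
  apply: mt_min; rewrite /euclid_sphere /= euclid_dot_col_mx.
  rewrite [X in _ + X]/euclid_dot tr_scalar_mx -scalar_mxM mxE eqxx mulr1n.
  by rewrite -expr2 sqr_sqrtr ?subr_ge0 // addrC subrK.
by move=> i; rewrite euclid_dot_embedded_point Wt mxE.
Qed.
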